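(* Let $l\in\mathbf Z_{\ge0}$ and $-2\le m\le2$ be such that the irreducible $\mathfrak{sl}(2,\mathbf C)$-module $V_{l+2m}$ occurs in $V_l\otimes_{\mathbf C}V_4$. Define a linear map $I^l_{2m}:V_{l+2m}\to V_l\otimes_{\mathbf C}V_4$ by $$I^l_{2m}(v^{(l+2m)}_k)=\sum_{i=0}^4A_{[l,2m;k,i]}\,v^{(l)}_{k+2-m-i}\otimes w_i\qquad(0\le k\le l+2m),$$ where $A_{[l,2m;k,i]}=a(l,2m;k,i)/d(l,2m)$ with the following values. $m=2$: $a(l,4;k,0)=(l+4-k)(l+3-k)(l+2-k)(l+1-k)$, $a(l,4;k,1)=4(l+4-k)(l+3-k)(l+2-k)k$, $a(l,4;k,2)=6(l+4-k)(l+3-k)k(k-1)$, $a(l,4;k,3)=4(l+4-k)k(k-1)(k-2)$, $a(l,4;k,4)=k(k-1)(k-2)(k-3)$, $d(l,4)=(l+4)(l+3)(l+2)(l+1)$. $m=1$: $a(l,2;k,0)=(l+2-k)(l+1-k)(l-k)$, $a(l,2;k,1)=-(l+2-k)(l+1-k)(l-4k)$, $a(l,2;k,2)=-3(l+2-k)(l-2k+2)k$, $a(l,2;k,3)=-(3l-4k+8)k(k-1)$, $a(l,2;k,4)=-k(k-1)(k-2)$, $d(l,2)=(l+2)(l+1)l$. $m=0$: $a(l,0;k,0)=(l-k)(l-1-k)$, $a(l,0;k,1)=-2(l-k)(l-2k-1)$, $a(l,0;k,2)=l^2-6kl+6k^2-l$, $a(l,0;k,3)=2(l-2k+1)k$,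 $a(l,0;k,4)=k(k-1)$, $d(l,0)=l(l-1)$. $m=-1$: $a(l,-2;k,0)=l-k-2$, $a(l,-2;k,1)=-(3l-4k-6)$, $a(l,-2;k,2)=3(l-2k-2)$, $a(l,-2;k,3)=-(l-4k-2)$, $a(l,-2;k,4)=-k$, $d(l,-2)=l-2$. $m=-2$: $a(l,-4;k,0)=1$, $a(l,-4;k,1)=-4$, $a(l,-4;k,2)=6$, $a(l,-4;k,3)=-4$, $a(l,-4;k,4)=1$, $d(l,-4)=1$. Then $I^l_{2m}$ is a generator of $\mathrm{Hom}_{\mathfrak{sl}(2,\mathbf C)}(V_{l+2m},V_l\otimes_{\mathbf C}V_4)$, which is unique up to scalar multiple.
   Context: $V_l$ is the space of homogeneous polynomials of degree $l$ in $\mathbf C[x,y]$, with standard basis $v^{(l)}_k=x^ky^{l-k}$ ($0\le k\le l$) and the convention $v^{(l)}_k=0$ for $k<0$ or $k>l$; $w_i=v^{(4)}_i$ ($0\le i\le4$) is the standard basis of $V_4$. $V_l$ is the irreducible $\mathfrak{sl}(2,\mathbf C)$-module of dimension $l+1$ on which an $\mathfrak{sl}_2$-triple $\{E,H,F\}$ spanning $\mathfrak{sl}(2,\mathbf C)=\mathfrak{su}(2)_{\mathbf C}$ acts by $$\tau_l(H)v_k=(l-2k)v_k,\quad\tau_l(E)v_k=-k\,v_{k-1},\quad\tau_l(F)v_k=(k-l)v_{k+1}$$ (this is the differential of the $SU(2)$-action $\tau_l(g)f(x,y)=f(ax+by,-\bar bx+\bar ay)$ for $g^{-1}=\begin{pmatrix}a&b\\-\bar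 b&\bar a\end{pmatrix}$). The tensor product carries the usual tensor product action. *)

(* Defs.v *)
From HB Require Import structures.
From mathcomp Require Import all_boot all_order all_algebra.
From mathcomp Require Import complex reals.
From mathcomp Require Import mpoly.
From mathcomp Require Import ring.

Set Implicit Arguments.
Unset Strict Implicit.
Unset Printing Implicit Defensive.

Import Order.TTheory GRing.Theory Num.Theory.

Local Open Scope ring_scope.

Section Tensor.
Variable K : fieldType.

(* The tensor product of finite-dimensional spaces V and W, modelled as the
   space of coordinate arrays with respect to the library bases of V and W;
   its universal property is tens_universal. *)
Definition tens (V W : vectType K) : vectType K :=
  'M[K]_(\dim {:V}, \dim {:W}).

Definition ptens (V W : vectType K) (v : V) (w : W) : tens V W :=
  \matrix_(i, j) (coord (vbasis {:V}) i v * coord (vbasis {:W}) j w).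

(* The linear map on tens V W sending ptens v w to b v w, for b bilinear. *)
Definition tens_ext (V W : vectType K) (U : lmodType K) (b : V -> W -> U)
    (t : tens V W) : U :=
  \sum_i \sum_j (t : 'M_(_, _)) i j *: b (vbasis {:V})`_i (vbasis {:W})`_j.

Fact tens_ext_is_linear (V W : vectType K) (U : lmodType K) (b : V -> W -> U) :
  linear (tens_ext b).
Proof.
move=> c s t; rewrite /tens_ext scaler_sumr -big_split /=.
apply: eq_bigr => i _; rewrite scaler_sumr -big_split /=.
by apply: eq_bigr => j _; rewrite !mxE scalerDl scalerA.
Qed.

HB.instance Definition _ (V W : vectType K) (U : lmodType K) (b : V -> W -> U) :=
  GRing.isLinear.Build K (tens V W) U _ (tens_ext b) (tens_ext_is_linear b).

Lemma ptens_linearl (V W : vectType K) (w : W) : linear (fun v : V => ptens v w).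
Proof.
by move=> c u v; apply/matrixP => i j; rewrite !mxE linearP /= mulrDl mulrA.
Qed.

Lemma ptens_linearr (V W : vectType K) (v : V) : linear (fun w : W => ptens v w).
Proof.
by move=> c u w; apply/matrixP => i j; rewrite !mxE linearP /= mulrDr mulrCA.
Qed.

Lemma tens_decomp (V W : vectType K) (t : tens V W) :
  t = tens_ext (@ptens V W) t.
Proof.
rewrite /tens_ext {1}[t]matrix_sum_delta.
apply: eq_bigr => i _; apply: eq_bigr => j _; congr (_ *: _).
apply/matrixP => i' j'; rewrite !mxE.
rewrite !coord_free ?(basis_free (vbasisP _)) //.
by rewrite -natrM mulnb eq_sym [j' == j]eq_sym.
Qed.

Lemma tens_extE (V W : vectType K) (U : lmodType K) (b : V -> W -> U) v w :
    (forall w, linear (b^~ w)) -> (forall v, linear (b v)) ->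
  tens_ext b (ptens v w) = b v w.
Proof.
move=> bl br.
have suml w' (I : finType) (c : I -> K) x :
    b (\sum_i c i *: x i) w' = \sum_i c i *: b (x i) w'.
  pose h := GRing.isLinear.Build K V U _ (b^~ w') (bl w').
  pose f : {linear V -> U} := HB.pack (b^~ w') h.
  rewrite -[LHS]/(f _) linear_sum; apply: eq_bigr => i _.
  by rewrite linearZ.
have sumr v' (I : finType) (c : I -> K) x :
    b v' (\sum_i c i *: x i) = \sum_i c i *: b v' (x i).
  pose h := GRing.isLinear.Build K W U _ (b v') (br v').
  pose f : {linear W -> U} := HB.pack (b v') h.
  rewrite -[LHS]/(f _) linear_sum; apply: eq_bigr => i _.
  by rewrite linearZ.
rewrite [in RHS](coord_vbasis (memvf v)) suml /tens_ext.
apply: eq_bigr => i _; rewrite [in RHS](coord_vbasis (memvf w)) sumr scaler_sumr.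
by apply: eq_bigr => j _; rewrite mxE scalerA.
Qed.

Lemma tens_universal (V W : vectType K) (U : lmodType K) (b : V -> W -> U) :
    (forall w, linear (b^~ w)) -> (forall v, linear (b v)) ->
  exists2 g : {linear tens V W -> U}, (forall v w, g (ptens v w) = b v w)
    & forall h : {linear tens V W -> U},
        (forall v w, h (ptens v w) = b v w) -> h =1 g.
Proof.
move=> bl br; exists (tens_ext b : {linear tens V W -> U}).
  by move=> v w; exact: tens_extE.
move=> h hb t; rewrite [in LHS](tens_decomp t) /tens_ext linear_sum /=.
apply: eq_bigr => i _; rewrite linear_sum; apply: eq_bigr => j _.
by rewrite linearZ hb.
Qed.

Lemma tens_lfunP (V W U : vectType K) (f g : 'Hom(tens V W, U)) :
  (forall v w, f (ptens v w) = g (ptens v w)) -> f = g.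
Proof.
move=> fg; apply/lfunP => t; rewrite (tens_decomp t) /tens_ext.
rewrite !linear_sum; apply: eq_bigr => i _; rewrite !linear_sum.
by apply: eq_bigr => j _; rewrite !linearZ /= fg.
Qed.

End Tensor.

Section Sl2.
Variable K : fieldType.

Definition sl2 : {pred 'M[K]_2} := [pred X | \tr X == 0].

(* Only the values of an action at elements of sl2 are meaningful. *)
Definition sl2_rep (V : vectType K) (rho : 'M[K]_2 -> 'End(V)) : Prop :=
  (forall c X Y, X \in sl2 -> Y \in sl2 ->
     rho (c *: X + Y) = c *: rho X + rho Y) /\
  (forall X Y, X \in sl2 -> Y \in sl2 ->
     rho (X *m Y - Y *m X) = (rho X \o rho Y)%VF - (rho Y \o rho X)%VF).

Definition tens_act (V W : vectType K)
    (rho : 'M[K]_2 -> 'End(V)) (sigma : 'M[K]_2 -> 'End(W)) (X : 'M[K]_2) :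
    'End(tens V W) :=
  linfun (tens_ext (fun v w => ptens (rho X v) w + ptens v (sigma X w))).

Definition sl2_hom (V W : vectType K) (rho : 'M[K]_2 -> 'End(V))
    (sigma : 'M[K]_2 -> 'End(W)) (f : 'Hom(V, W)) : Prop :=
  forall X, X \in sl2 -> forall v, f (rho X v) = sigma X (f v).

(* W has a submodule isomorphic to V; meant for irreducible V. *)
Definition sl2_occurs (V W : vectType K) (rho : 'M[K]_2 -> 'End(V))
    (sigma : 'M[K]_2 -> 'End(W)) : Prop :=
  exists2 f : 'Hom(V, W), sl2_hom rho sigma f & injective f.

Definition sl2_hom_generator (V W : vectType K) (rho : 'M[K]_2 -> 'End(V))
    (sigma : 'M[K]_2 -> 'End(W)) (f : 'Hom(V, W)) : Prop :=
  sl2_hom rho sigma f /\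
  (forall g : 'Hom(V, W), sl2_hom rho sigma g -> exists c : K, g = c *: f).

Lemma tens_actE (V W : vectType K)
    (rho : 'M[K]_2 -> 'End(V)) (sigma : 'M[K]_2 -> 'End(W)) X v w :
  tens_act rho sigma X (ptens v w) = ptens (rho X v) w + ptens v (sigma X w).
Proof.
rewrite lfunE /= tens_extE // => [w' c a b | v' c a b].
  by rewrite linearP /= !ptens_linearl scalerDr addrACA.
by rewrite linearP /= !ptens_linearr scalerDr addrACA.
Qed.

Lemma tens_act_rep (V W : vectType K)
    (rho : 'M[K]_2 -> 'End(V)) (sigma : 'M[K]_2 -> 'End(W)) :
  sl2_rep rho -> sl2_rep sigma -> sl2_rep (tens_act rho sigma).
Proof.
have ptBl (v v' : V) (w : W) : ptens (v - v') w = ptens v w - ptens v' w.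
  by rewrite addrC -scaleN1r ptens_linearl scaleN1r addrC.
have ptBr (v : V) (w w' : W) : ptens v (w - w') = ptens v w - ptens v w'.
  by rewrite addrC -scaleN1r ptens_linearr scaleN1r addrC.
move=> [rl rb] [sl sb]; split=> [c X Y hX hY|X Y hX hY]; apply: tens_lfunP => v w.
  rewrite add_lfunE scale_lfunE !tens_actE rl // sl // !add_lfunE !scale_lfunE.
  by rewrite ptens_linearl ptens_linearr scalerDr addrACA.
rewrite add_lfunE opp_lfunE !comp_lfunE !tens_actE !linearD /= !tens_actE.
rewrite rb // sb // !add_lfunE !opp_lfunE !comp_lfunE ptBl ptBr !opprD.
move: (ptens _ _) (ptens _ _) (ptens _ _) (ptens _ _) (ptens _ _) (ptens _ _).
move=> a b c d e f.
by rewrite addrACA -[in RHS]addrA [in RHS]addrC; apply/matrixP => i j; rewrite !mxE; ring.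
Qed.

Definition hpoly (l : nat) : vectType K := dhomog 2%N K l.

(* The monomial x^k y^(l-k), with x = 'X_0 and y = 'X_1, and 0 for k outside
   of [0, l]. *)
Definition hmon (l : nat) (k : int) : hpoly l :=
  match k with
  | Posz k => if (k <= l)%N
              then indhomog l ('X_0 ^+ k * 'X_1 ^+ (l - k) : {mpoly K[2]})
              else 0
  | Negz _ => 0
  end.

Arguments hmon : simpl never.

(* The linear map on hpoly l sending hmon l k to g k for 0 <= k <= l. *)
Definition hpoly_ext (l : nat) (U : lmodType K) (g : int -> U)
    (f : hpoly l) : U :=
  \sum_(k < l.+1)
     (mpoly_of_dhomog f)@_[multinom [tuple (k : nat); (l - k)%N]] *: g k%:Z.

Fact hpoly_ext_is_linear (l : nat) (U : lmodType K) (g : int -> U) :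
  linear (@hpoly_ext l U g).
Proof.
move=> c s t; rewrite /hpoly_ext scaler_sumr -big_split /=.
by apply: eq_bigr => i _; rewrite linearP /= scalerDl scalerA.
Qed.

HB.instance Definition _ (l : nat) (U : lmodType K) (g : int -> U) :=
  GRing.isLinear.Build K (hpoly l) U _ (@hpoly_ext l U g)
    (hpoly_ext_is_linear g).

Lemma hmon_val (l k : nat) : (k <= l)%N ->
  mpoly_of_dhomog (hmon l k) = 'X_0 ^+ k * 'X_1 ^+ (l - k).
Proof.
move=> kl; rewrite /hmon kl /indhomog insubdK //.
rewrite unfold_in -[X in X.-homog](subnKC kl).
have h (i : 'I_2) n : ('X_i ^+ n : {mpoly K[2]}) \is n.-homog.
  by rewrite -[n in n.-homog]mul1n; apply: dhomogMn; rewrite dhomogX /= mdeg1.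
exact: dhomogM.
Qed.

Lemma hmon_valX (l k : nat) : (k <= l)%N ->
  mpoly_of_dhomog (hmon l k) = 'X_[[multinom [tuple k; (l - k)%N]]].
Proof.
move=> kl; rewrite hmon_val // [in RHS]mpolyXE_id !big_ord_recl big_ord0 mulr1.
rewrite !multinomE !(tnth_nth 0%N) /=.
by congr (_ * _); congr (_ ^+ _); congr ('X_[U_(_)]); apply/val_inj.
Qed.

Lemma hpoly_extE (l : nat) (U : lmodType K) (g : int -> U) (k : nat) :
  (k <= l)%N -> hpoly_ext g (hmon l k) = g k.
Proof.
move=> kl; rewrite /hpoly_ext hmon_valX //.
rewrite (bigD1 (Ordinal (kl : (k < l.+1)%N))) //=.
rewrite mcoeffX eqxx scale1r big1 ?addr0 // => i ik.
rewrite mcoeffX; case: eqP => [/(congr1 (fun m : 'X_{1..2} => m 0))|_]; last first.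
  by rewrite scale0r.
rewrite !multinomE !(tnth_nth 0%N) /= => ki; case/negP: ik.
by apply/eqP/val_inj; rewrite /= ki.
Qed.

Lemma hpoly_decomp (l : nat) (f : hpoly l) : f = hpoly_ext (hmon l) f.
Proof.
apply/val_inj/mpolyP => m /=; rewrite /hpoly_ext raddf_sum /= raddf_sum /=.
have [ml|ml] := eqVneq (mdeg m) l; last first.
  rewrite (@dhomog_nemf_coeff _ _ mdeg l) ?dhomog_is_dhomog //.
  rewrite big1 // => i _; rewrite linearZ /=.
  by rewrite [X in _ * X](@dhomog_nemf_coeff _ _ mdeg l) ?mulr0 // dhomog_is_dhomog.
have ml2 : (m 0%R + m 1%R = l)%N.
  rewrite -ml mdegE !big_ord_recl big_ord0 addn0.
  by congr (m _ + m _)%N; apply/val_inj.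
have m0l : (m 0%R < l.+1)%N by rewrite ltnS -ml2 leq_addr.
have mE : m = [multinom [tuple m 0; (l - m 0%R)%N]].
  apply/mnmP => i; rewrite multinomE (tnth_nth 0%N).
  case: i => [[|[|i]] hi] //=; last rewrite -ml2 addKn; by congr (m _); apply/val_inj.
rewrite (bigD1 (Ordinal m0l)) //= linearZ /= hmon_valX // mcoeffX.
rewrite [X in X == m](_ : _ = m); last by rewrite {2}mE.
rewrite [X in (mpoly_of_dhomog f)@_X * _](_ : _ = m); last by rewrite {2}mE.
rewrite eqxx mulr1 big1 ?addr0 // => i im.
rewrite linearZ /= hmon_valX -1?ltnS // mcoeffX.
rewrite [X in nat_of_bool X](_ : _ = false) ?mulr0 //.
apply: contra_neqF im => /eqP e; apply/val_inj; rewrite /= -e.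
by rewrite multinomE (tnth_nth 0%N).
Qed.

Lemma hpoly_lfunP (l : nat) (U : vectType K) (f g : 'Hom(hpoly l, U)) :
  (forall k : nat, (k <= l)%N -> f (hmon l k) = g (hmon l k)) -> f = g.
Proof.
move=> fg; apply/lfunP => v; rewrite (hpoly_decomp v) /hpoly_ext !linear_sum.
by apply: eq_bigr => i _; rewrite !linearZ /= fg // -ltnS.
Qed.

Definition tauH (l : nat) : 'End(hpoly l) :=
  linfun (hpoly_ext (fun k => (l%:Z - 2 * k)%:~R *: hmon l k)).
Definition tauE (l : nat) : 'End(hpoly l) :=
  linfun (hpoly_ext (fun k => (- k)%:~R *: hmon l (k - 1))).
Definition tauF (l : nat) : 'End(hpoly l) :=
  linfun (hpoly_ext (fun k => (k - l%:Z)%:~R *: hmon l (k + 1))).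

(* H = diag(1, -1), E and F are the elementary matrices: differentiating
   f(x - t (X00 x + X01 y), y - t (X10 x + X11 y)) at t = 0 gives
   H = y d/dy - x d/dx, E = - y d/dx, F = - x d/dy. *)
Definition tau (l : nat) (X : 'M[K]_2) : 'End(hpoly l) :=
  X 0 0 *: tauH l + X 0 1 *: tauE l + X 1 0 *: tauF l.

Lemma hmon_out (l : nat) (k : int) : ~~ (0 <= k <= l%:Z) -> hmon l k = 0.
Proof. by case: k => [k|k] //; rewrite /hmon /= lez_nat => /negPf ->. Qed.

Lemma tauHE (l : nat) (k : int) :
  tauH l (hmon l k) = (l%:Z - 2 * k)%:~R *: hmon l k.
Proof.
have [|/hmon_out ->] := boolP (0 <= k <= l%:Z); last by rewrite linear0 scaler0.
by case: k => // k; rewrite lez_nat => kl; rewrite lfunE /= hpoly_extE.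
Qed.

Lemma tauEE (l : nat) (k : int) : 0 <= k <= l%:Z ->
  tauE l (hmon l k) = (- k)%:~R *: hmon l (k - 1).
Proof.
by case: k => // k; rewrite lez_nat => kl; rewrite lfunE /= hpoly_extE.
Qed.

Lemma tauFE (l : nat) (k : int) : 0 <= k <= l%:Z ->
  tauF l (hmon l k) = (k - l%:Z)%:~R *: hmon l (k + 1).
Proof.
by case: k => // k; rewrite lez_nat => kl; rewrite lfunE /= hpoly_extE.
Qed.

Lemma tau_rep (l : nat) : sl2_rep (tau l).
Proof.
have tr (X : 'M[K]_2) : X \in sl2 -> X 1 1 = - X 0 0.
  rewrite inE /mxtrace !big_ord_recl big_ord0 addr0 addrC addr_eq0 => /eqP <-.
  by congr (X _ _); apply/val_inj.
have HE : (tauH l \o tauE l)%VF - (tauE l \o tauH l)%VF = 2 *: tauE l.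
  apply: hpoly_lfunP => k kl; rewrite add_lfunE opp_lfunE !comp_lfunE scale_lfunE.
  rewrite tauHE !linearZ /= tauEE // linearZ /= tauHE scalerN !scalerA -scalerBl.
  by congr (_ *: _); ring.
have HF : (tauH l \o tauF l)%VF - (tauF l \o tauH l)%VF = - 2 *: tauF l.
  apply: hpoly_lfunP => k kl; rewrite add_lfunE opp_lfunE !comp_lfunE scale_lfunE.
  rewrite tauHE !linearZ /= tauFE // linearZ /= tauHE scalerN !scalerA -scalerBl.
  by congr (_ *: _); ring.
have EF : (tauE l \o tauF l)%VF - (tauF l \o tauE l)%VF = tauH l.
  apply: hpoly_lfunP => k kl; rewrite add_lfunE opp_lfunE !comp_lfunE.
  rewrite tauHE tauEE // tauFE // !linearZ /= ?scalerN.
  have -> : (k%:Z - l%:Z)%:~R *: tauE l (hmon l (k%:Z + 1)) =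
      ((l%:Z - k%:Z) * (k%:Z + 1))%:~R *: hmon l k.
    have [->|nkl] := eqVneq k l; first by rewrite subrr mul0r !scale0r.
    rewrite tauEE; last by rewrite -PoszD addn1 lez_nat ltn_neqAle nkl.
    by rewrite scalerA addrK -intrM; congr (_%:~R *: _); ring.
  have -> : (- k%:Z)%:~R *: tauF l (hmon l (k%:Z - 1)) =
      (- k%:Z * (k%:Z - 1 - l%:Z))%:~R *: hmon l k.
    have [->|k0] := posnP k; first by rewrite oppr0 mul0r !scale0r.
    rewrite tauFE; last by rewrite subr_ge0 lez_nat k0 lerBlDr -PoszD lez_nat addn1 leqW.
    by rewrite scalerA subrK -intrM.
  by rewrite -scalerBl -intrB; congr (_%:~R *: _); ring.
split=> [c X Y hX hY|X Y hX hY]; apply/lfunP => v.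
  rewrite /tau !mxE !(add_lfunE, scale_lfunE); apply: val_inj.
  by rewrite /= !(linearD, linearZ) /= -!mul_mpolyC !(rmorphD, rmorphM) /=; ring.
move/lfunP/(_ v): HE; move/lfunP/(_ v): HF; move/lfunP/(_ v): EF; rewrite /tau !mxE !big_ord_recl !big_ord0 !addr0.
have -> : lift ord0 ord0 = 1 :> 'I_2 by apply/val_inj.
rewrite (tr X hX) (tr Y hY).
rewrite !(add_lfunE, opp_lfunE, scale_lfunE, comp_lfunE, linearD, linearZ, linearN) /=.
move=> /(canRL (subrK _)) -> /(canRL (subrK _)) -> /(canRL (subrK _)) ->.
rewrite -[ord0]/(0 : 'I_2); apply: val_inj.
rewrite /= !(linearD, linearZ, linearN) /= -!mul_mpolyC.
by rewrite !(rmorphD, rmorphM, rmorphN) /=; ring.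
Qed.

(* The numerators a(l, 2m; k, i), 0 <= i <= 4, and the denominators d(l, 2m). *)
Definition coef_num (l m k : int) (i : nat) : int :=
  nth 0
    (if m == 2 then
       [:: (l + 4 - k) * (l + 3 - k) * (l + 2 - k) * (l + 1 - k);
           4 * (l + 4 - k) * (l + 3 - k) * (l + 2 - k) * k;
           6 * (l + 4 - k) * (l + 3 - k) * k * (k - 1);
           4 * (l + 4 - k) * k * (k - 1) * (k - 2);
           k * (k - 1) * (k - 2) * (k - 3)]
     else if m == 1 then
       [:: (l + 2 - k) * (l + 1 - k) * (l - k);
           - (l + 2 - k) * (l + 1 - k) * (l - 4 * k);
           - 3 * (l + 2 - k) * (l - 2 * k + 2) * k;
           - (3 * l - 4 * k + 8) * k * (k - 1);
           - k * (k - 1) * (k - 2)]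
     else if m == 0 then
       [:: (l - k) * (l - 1 - k);
           - 2 * (l - k) * (l - 2 * k - 1);
           l ^+ 2 - 6 * k * l + 6 * k ^+ 2 - l;
           2 * (l - 2 * k + 1) * k;
           k * (k - 1)]
     else if m == - 1 then
       [:: l - k - 2;
           - (3 * l - 4 * k - 6);
           3 * (l - 2 * k - 2);
           - (l - 4 * k - 2);
           - k]
     else if m == - 2 then [:: 1; - 4; 6; - 4; 1]
     else [::]) i.

Definition coef_den (l m : int) : int :=
  if m == 2 then (l + 4) * (l + 3) * (l + 2) * (l + 1)
  else if m == 1 then (l + 2) * (l + 1) * l
  else if m == 0 then l * (l - 1)
  else if m == - 1 then l - 2
  else 1.

Definition coef (l m k : int) (i : nat) : K :=
  (coef_num l m k i)%:~R / (coef_den l m)%:~R.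

(* The map I^l_{2m}; meaningful for n = l + 2m. *)
Definition Imap (l : nat) (m : int) (n : nat) :
    'Hom(hpoly n, tens (hpoly l) (hpoly 4)) :=
  linfun (hpoly_ext (fun k =>
    \sum_(i < 5) coef l m k i *: ptens (hmon l (k + 2 - m - i%:Z)) (hmon 4 i%:Z))).

Lemma ImapE (l : nat) (m : int) (n k : nat) : (k <= n)%N ->
  Imap l m n (hmon n k) =
  \sum_(i < 5) coef l m k i *: ptens (hmon l (k%:Z + 2 - m - i%:Z)) (hmon 4 i%:Z).
Proof. by move=> kn; rewrite lfunE /= hpoly_extE. Qed.

End Sl2.

Arguments tau K l X : clear implicits.

(* Main.v *)
(* In coordinates, equivariance of Imap amounts to recursions between the
   coefficients coef_num, which are polynomial identities in l and k.
   Conversely F generates V_n from v_0, so that a homomorphism f is determined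
   by f v_0; this vector has weight n and is killed by E, hence is determined
   by its coordinate on v_{2-m} (x) w_0, which is 1 for Imap.  This coordinate
   is 0 when l + m < 2, so that if V_n occurs then 2 <= l + m, which ensures
   that the denominators do not vanish. *)
From HB Require Import structures.
Require Import Defs.
From mathcomp Require Import all_boot all_order all_algebra.
From mathcomp Require Import complex reals.
From mathcomp Require Import zify ring.

Import Order.TTheory GRing.Theory Num.Theory.

Local Open Scope ring_scope.

Arguments hmon : simpl never.

(** * Coordinates on V_l and on tensor products, and the action in these coordinates *)

Section Coordinates.
Variable K : fieldType.

(* Coordinates are indexed by all of Z, and vanish outside of [0, l], so that
   hcoef_tau and tcoef_tens_act hold without side conditions. *)
Definition hcoef (l : nat) (k : int) : 'Hom(hpoly K l, K^o) :=
  linfun (hpoly_ext (fun k' => (k' == k)%:R : K^o)).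

Lemma hcoef_hmon (l : nat) (k k' : int) :
  hcoef l k (hmon K l k') = ((k' == k) && (0 <= k' <= l%:Z))%:R.
Proof.
have [|k'l] := boolP (0 <= k' <= l%:Z); last by rewrite hmon_out // linear0 andbF.
by case: k' => // k'; rewrite lez_nat => k'l; rewrite lfunE /= hpoly_extE // andbT.
Qed.

Lemma hcoef_decomp (l : nat) (v : hpoly K l) :
  v = \sum_(k < l.+1) hcoef l k v *: hmon K l k.
Proof.
rewrite {1}(hpoly_decomp v); apply: eq_bigr => k _; congr (_ *: _).
rewrite lfunE /= /hpoly_ext (bigD1 k) //= big1 => [|i ik].
  by rewrite addr0 /GRing.scale /= (eqxx k%:Z) mulr1.
by rewrite eqz_nat (negPf ik : (i == k :> nat) = false) scaler0.
Qed.

Lemma hcoef_tau (l : nat) (X : 'M[K]_2) (k : int) (v : hpoly K l) :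
  hcoef l k (tau K l X v) =
    X 0 0 * (l%:Z - 2 * k)%:~R * hcoef l k v
    - X 0 1 * (k + 1)%:~R * hcoef l (k + 1) v
    + X 1 0 * (k - 1 - l%:Z)%:~R * hcoef l (k - 1) v.
Proof.
have : (hcoef l k \o tau K l X)%VF =
    (X 0 0 * (l%:Z - 2 * k)%:~R) *: hcoef l k
    - (X 0 1 * (k + 1)%:~R) *: hcoef l (k + 1)
    + (X 1 0 * (k - 1 - l%:Z)%:~R) *: hcoef l (k - 1).
  apply: hpoly_lfunP => k' k'l; rewrite comp_lfunE /tau.
  rewrite !(add_lfunE, opp_lfunE, scale_lfunE) tauHE tauEE // tauFE //.
  rewrite !linearD !linearZ /= !hcoef_hmon /GRing.scale /= -!mulrA.
  rewrite !lez_nat k'l /= !andbT.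
  congr (_ * _ + _ * _ + _ * _).
  - by case: eqP => [->|]; rewrite ?mulr0.
  - rewrite subr_eq; case: eqP => [e|_]; last by rewrite /= !(mulr0, mulr0n, oppr0).
    (* For [k' = 0] the vector v_{-1} is 0 although the indices match; the factor [k + 1 = k'] makes
       the other side vanish too. For F below, [k' - l] does the same at [k' = l]. *)
    have [k'0|k'0] := posnP k'; first by rewrite -e k'0 !(oppr0, mulr0z, mul0r).
    by rewrite -e mulrN -mulNr intrN (_ : 0 <= _ <= _ = true); [|lia].
  - rewrite [k'%:Z == _]eq_sym subr_eq [k == _]eq_sym.
    case: eqP => [<-|_]; last by rewrite !mulr0.
    have [->|k'l'] := eqVneq k' l; first by rewrite addrK subrr !(mulr0z, mul0r).
    by rewrite addrK (_ : (k' + 1 <= l)%N = true); [|lia].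
by move/lfunP/(_ v); rewrite comp_lfunE !(add_lfunE, opp_lfunE, scale_lfunE).
Qed.

Definition tcoef (l l' : nat) (j i : int) :
    'Hom(tens (hpoly K l) (hpoly K l'), K^o) :=
  linfun (tens_ext (fun v w => hcoef l j v * hcoef l' i w : K^o)).

Lemma tcoef_ptens (l l' : nat) (j i : int) (v : hpoly K l) (w : hpoly K l') :
  tcoef l l' j i (ptens v w) = hcoef l j v * hcoef l' i w.
Proof.
rewrite lfunE /= tens_extE // => [w' c a b|v' c a b]; rewrite linearP /=.
  by rewrite mulrDl /GRing.scale /= mulrA.
by rewrite mulrDr /GRing.scale /= mulrCA.
Qed.

Lemma tcoef_decomp (l l' : nat) (t : tens (hpoly K l) (hpoly K l')) :
  t = \sum_(j < l.+1) \sum_(i < l'.+1)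
        tcoef l l' j i t *: ptens (hmon K l j) (hmon K l' i).
Proof.
(* The right-hand side is linear in [t], so it suffices to compare on pure tensors. *)
pose s t := \sum_(j < l.+1) \sum_(i < l'.+1)
  tcoef l l' j i t *: ptens (hmon K l j) (hmon K l' i).
have slin : linear s.
  move=> c u v; rewrite /s scaler_sumr -big_split; apply: eq_bigr => j _.
  rewrite scaler_sumr -big_split; apply: eq_bigr => i _ /=.
  by rewrite linearP scalerDl scalerA.
pose f : {linear _ -> _} := HB.pack s (GRing.isLinear.Build K _ _ _ s slin).
suff /lfunP/(_ t) : \1%VF = linfun f by rewrite id_lfunE lfunE.
apply: tens_lfunP => v w; rewrite id_lfunE lfunE /= /s.
apply/matrixP => a b; rewrite mxE summxE.
rewrite [in LHS](hcoef_decomp _ v) linear_sum mulr_suml; apply: eq_bigr => j _.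
rewrite [in LHS](hcoef_decomp _ w) linear_sum mulr_sumr summxE.
apply: eq_bigr => i _; rewrite !linearZ !mxE tcoef_ptens.
by rewrite /GRing.scale /= mulrACA.
Qed.

Lemma tcoef_tens_act (l l' : nat) (X : 'M[K]_2) (j i : int)
    (t : tens (hpoly K l) (hpoly K l')) :
  tcoef l l' j i (tens_act (tau K l) (tau K l') X t) =
    X 0 0 * (l%:Z - 2 * j + l'%:Z - 2 * i)%:~R * tcoef l l' j i t
    - X 0 1 * ((j + 1)%:~R * tcoef l l' (j + 1) i t +
               (i + 1)%:~R * tcoef l l' j (i + 1) t)
    + X 1 0 * ((j - 1 - l%:Z)%:~R * tcoef l l' (j - 1) i t +
               (i - 1 - l'%:Z)%:~R * tcoef l l' j (i - 1) t).
Proof.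
have : (tcoef l l' j i \o tens_act (tau K l) (tau K l') X)%VF =
    (X 0 0 * (l%:Z - 2 * j + l'%:Z - 2 * i)%:~R) *: tcoef l l' j i
    - X 0 1 *: ((j + 1)%:~R *: tcoef l l' (j + 1) i +
               (i + 1)%:~R *: tcoef l l' j (i + 1))
    + X 1 0 *: ((j - 1 - l%:Z)%:~R *: tcoef l l' (j - 1) i +
               (i - 1 - l'%:Z)%:~R *: tcoef l l' j (i - 1)).
  apply: tens_lfunP => v w; rewrite comp_lfunE tens_actE linearD /=.
  rewrite !tcoef_ptens !hcoef_tau !(add_lfunE, opp_lfunE, scale_lfunE).
  rewrite !tcoef_ptens /GRing.scale /=.
  set a := hcoef _ _ _; set b := hcoef _ _ _; set c := hcoef _ _ _.
  set a' := hcoef _ _ _; set b' := hcoef _ _ _; set c' := hcoef _ _ _.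
  by ring.
by move/lfunP/(_ t); rewrite comp_lfunE !(add_lfunE, opp_lfunE, scale_lfunE).
Qed.

Lemma tcoef_eq (l l' : nat) (s t : tens (hpoly K l) (hpoly K l')) :
    (forall j i : nat, (j <= l)%N -> (i <= l')%N ->
       tcoef l l' j i s = tcoef l l' j i t) ->
  s = t.
Proof.
move=> st; rewrite (tcoef_decomp _ _ s) (tcoef_decomp _ _ t).
apply: eq_bigr => j _; apply: eq_bigr => i _.
by rewrite st // -ltnS.
Qed.

Lemma tcoef_out (l l' : nat) (j i : int) (t : tens (hpoly K l) (hpoly K l')) :
  ~~ ((0 <= j <= l%:Z) && (0 <= i <= l'%:Z)) -> tcoef l l' j i t = 0.
Proof.
move=> out; rewrite (tcoef_decomp _ _ t) linear_sum big1 // => a _.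
rewrite linear_sum big1 // => b _; rewrite linearZ /= tcoef_ptens !hcoef_hmon.
rewrite -natrM mulnb [X in nat_of_bool X](_ : _ = false) ?scaler0 //.
apply: contraNF out => /andP[/andP[/eqP <- ->] /andP[/eqP <- ->]] //.
Qed.

End Coordinates.

(** * Polynomial identities between the numerators *)

(** Being 0 at i = -1 and, by the default of [nth], at i = 5, this lets the recursions hold at both
    ends without special cases. *)
Definition coefz (l m k i : int) : int :=
  match i with Posz i => coef_num l m k i | Negz _ => 0 end.

Lemma int_range2 (m : int) : - 2 <= m <= 2 -> m \in [:: 2; 1; 0; - 1; - 2].
Proof. by rewrite !inE; lia. Qed.

(** This is I(E v_k) = E I(v_k) read at v_{k+1-m-i} (x) w_i, with sign and denominator removed. *)
Lemma coefz_recE (l m k : int) (i : nat) : - 2 <= m <= 2 -> (i <= 4)%N ->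
  k * coefz l m (k - 1) i =
  (k + 2 - m - i%:Z) * coefz l m k i + (i%:Z + 1) * coefz l m k (i%:Z + 1).
Proof.
move=> /int_range2; rewrite !inE => /or4P[|||/orP[]] /eqP ->;
  case: i => [|[|[|[|[|//]]]]] _; rewrite /coefz /coef_num /=; ring.
Qed.

(** Likewise for F, read at v_{k+3-m-i} (x) w_i. *)
Lemma coefz_recF (l m k : int) (i : nat) : - 2 <= m <= 2 -> (i <= 4)%N ->
  (k - (l + 2 * m)) * coefz l m (k + 1) i =
  (k + 2 - m - i%:Z - l) * coefz l m k i + (i%:Z - 5) * coefz l m k (i%:Z - 1).
Proof.
move=> /int_range2; rewrite !inE => /or4P[|||/orP[]] /eqP ->;
  case: i => [|[|[|[|[|//]]]]] _; rewrite /coefz /coef_num /=; ring.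
Qed.

(* The recursions involve a coefficient of v_{l+1} (resp. v_{-1}), which is
   spurious since these vectors are 0: it has to vanish. *)
Lemma coefz_top (l m k : int) (i : nat) : - 2 <= m <= 2 -> (i <= 4)%N ->
  k <= l + 2 * m -> k = l + m - 1 + i%:Z -> coefz l m k i = 0.
Proof.
move=> /int_range2; rewrite !inE => /or4P[|||/orP[]] /eqP ->;
  (* The two conditions on [k] force i <= m + 1; the other cases are contradictory. *)
  case: i => [|[|[|[|[|//]]]]] _ kn ke; try (exfalso; lia);
  rewrite ke /coefz /coef_num /=; ring.
Qed.

Lemma coefz_bot (l m k : int) (i : nat) : - 2 <= m <= 2 -> (i <= 4)%N ->
  0 <= k -> k = i%:Z + m - 3 -> coefz l m k i = 0.
Proof.
move=> /int_range2; rewrite !inE => /or4P[|||/orP[]] /eqP ->;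
  case: i => [|[|[|[|[|//]]]]] _ kn ke; try (exfalso; lia);
  rewrite ke /coefz /coef_num /=; ring.
Qed.

Lemma coefz_00 (l m : int) : - 2 <= m <= 2 -> coefz l m 0 0 = coef_den l m.
Proof.
move=> /int_range2; rewrite !inE => /or4P[|||/orP[]] /eqP ->;
  rewrite /coefz /coef_num /coef_den /=; ring.
Qed.

Lemma coef_den_neq0 (l m : int) : - 2 <= m <= 2 -> 0 <= l -> 2 <= l + m ->
  coef_den l m != 0.
Proof.
move=> /int_range2; rewrite !inE => /or4P[|||/orP[]] /eqP ->;
  rewrite /coef_den /= => l0 lm; rewrite ?mulf_eq0; lia.
Qed.

(** The coordinate of I(v_k) at v_j (x) w_i times the denominator, for all integer indices; the
    range of [i] is built into [coefz]. *)
Definition Imap_num (l n : nat) (m k j i : int) : int :=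
  if [&& 0 <= k <= n%:Z, 0 <= j <= l%:Z & j + i == k + 2 - m]
  then coefz l m k i else 0.

(** * Equivariance of [Imap], and homomorphisms as determined by one coordinate *)

Section Hom.
Variables (K : numFieldType) (l n : nat) (m : int).
Hypotheses (hm : - 2 <= m <= 2) (hn : n%:Z = l%:Z + 2 * m).

Lemma Imap_num_recE (k j i : nat) : (k <= n)%N -> (j <= l)%N -> (i <= 4)%N ->
  k%:Z * Imap_num l n m (k%:Z - 1) j i =
  (j%:Z + 1) * Imap_num l n m k (j%:Z + 1) i +
  (i%:Z + 1) * Imap_num l n m k j (i%:Z + 1).
Proof.
move=> kn jl i4; rewrite /Imap_num.
(* Off this line all three terms are 0 for weight reasons. *)
have [e|ne] := eqVneq (j%:Z) (k%:Z + 1 - m - i%:Z); last first.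
  rewrite !ifF; lia.
have -> : [&& 0 <= k%:Z <= n%:Z, 0 <= j%:Z <= l%:Z &
             j%:Z + (i%:Z + 1) == k%:Z + 2 - m] by lia.
have := coefz_recE l m k i hm i4.
rewrite (_ : k%:Z + 2 - m - i%:Z = j%:Z + 1); last by lia.
have -> : [&& 0 <= k%:Z <= n%:Z, 0 <= j%:Z + 1 <= l%:Z &
             j%:Z + 1 + i%:Z == k%:Z + 2 - m] = (j != l) by lia.
have -> : [&& 0 <= k%:Z - 1 <= n%:Z, 0 <= j%:Z <= l%:Z &
             j%:Z + i%:Z == k%:Z - 1 + 2 - m] = (k != 0%N) by lia.
(* For [j = l] the term of v_{l+1} is missing, but its numerator is 0 by [coefz_top]; for [k = 0]
   the factor [k] removes the left-hand side. *)
have [jl'|_] := eqVneq j l.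
  rewrite (coefz_top l m k i) //; [|lia|lia].
  by case: eqVneq => [->|_] /=; rewrite ?mul0r.
by case: eqVneq => [->|_] /=; rewrite ?mul0r.
Qed.

Lemma Imap_num_recF (k j i : nat) : (k <= n)%N -> (j <= l)%N -> (i <= 4)%N ->
  (k%:Z - n%:Z) * Imap_num l n m (k%:Z + 1) j i =
  (j%:Z - 1 - l%:Z) * Imap_num l n m k (j%:Z - 1) i +
  (i%:Z - 1 - 4) * Imap_num l n m k j (i%:Z - 1).
Proof.
move=> kn jl i4; rewrite /Imap_num.
have [e|ne] := eqVneq (j%:Z) (k%:Z + 3 - m - i%:Z); last first.
  rewrite !ifF; lia.
have -> : [&& 0 <= k%:Z <= n%:Z, 0 <= j%:Z <= l%:Z &
             j%:Z + (i%:Z - 1) == k%:Z + 2 - m] by lia.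
have := coefz_recF l m k i hm i4.
rewrite (_ : k%:Z + 2 - m - i%:Z = j%:Z - 1); last by lia.
rewrite -hn (_ : i%:Z - 5 = i%:Z - 1 - 4); last by lia.
have -> : [&& 0 <= k%:Z <= n%:Z, 0 <= j%:Z - 1 <= l%:Z &
             j%:Z - 1 + i%:Z == k%:Z + 2 - m] = (j != 0%N) by lia.
have -> : [&& 0 <= k%:Z + 1 <= n%:Z, 0 <= j%:Z <= l%:Z &
             j%:Z + i%:Z == k%:Z + 1 + 2 - m] = (k != n) by lia.
(* Here the missing terms are that of v_{-1}, handled by [coefz_bot], and that of v_{n+1}, whose
   factor [k - n] is 0. *)
have [j0|_] := eqVneq j 0%N.
  rewrite (coefz_bot l m k i) //; [|lia].
  by case: eqVneq => [->|_] /=; rewrite ?subrr ?mul0r ?mulr0.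
by case: eqVneq => [->|_] /=; rewrite ?subrr ?mul0r.
Qed.

Lemma tcoef_Imap (k j i : int) :
  tcoef K l 4 j i (Imap K l m n (hmon K n k)) =
    (Imap_num l n m k j i)%:~R / (coef_den l m)%:~R.
Proof.
have [kn|kn] := boolP (0 <= k <= n%:Z); last first.
  by rewrite hmon_out // !linear0 /Imap_num (negPf kn) mul0r.
case: k kn => // k; rewrite lez_nat => kn; rewrite ImapE //.
have [i5|i5] := boolP (0 <= i <= 4); last first.
  rewrite tcoef_out ?(negPf i5) ?andbF // /Imap_num /coefz.
  case: i i5 => [i|i] i5; last by rewrite if_same mul0r.
  rewrite /coef_num nth_default ?if_same ?mul0r //.
  by repeat case: ifP => _ /=; lia.
case: i i5 => // i i4; have i5 : (i < 5)%N by lia.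
rewrite linear_sum (bigD1 (Ordinal i5)) //= big1 ?addr0 => [|a ai].
  rewrite linearZ /= tcoef_ptens !hcoef_hmon eqxx i4 mulr1 /Imap_num /coef /coefz.
  rewrite lez_nat kn /= /GRing.scale /=.
  have -> : (k%:Z + 2 - m - i%:Z == j) && (0 <= k%:Z + 2 - m - i%:Z <= l%:Z) =
    (0 <= j <= l%:Z) && (j + i%:Z == k%:Z + 2 - m) by lia.
  by case: ifP; rewrite ?mulr1 ?mulr0 ?mul0r.
rewrite linearZ /= tcoef_ptens !hcoef_hmon (_ : (a%:Z == i) = false) /=.
  by rewrite mulr0 scaler0.
by apply: contraNF ai => /eqP[ai]; apply/eqP/val_inj.
Qed.

Lemma tau_hmon (X : 'M[K]_2) (k : nat) : (k <= n)%N ->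
  tau K n X (hmon K n k) =
    (X 0 0 * (n%:Z - 2 * k%:Z)%:~R) *: hmon K n k
    + (X 0 1 * (- k%:Z)%:~R) *: hmon K n (k%:Z - 1)
    + (X 1 0 * (k%:Z - n%:Z)%:~R) *: hmon K n (k%:Z + 1).
Proof.
move=> kn; rewrite /tau !(add_lfunE, scale_lfunE) tauHE tauEE // tauFE //.
by rewrite !scalerA.
Qed.

Lemma Imap_hom :
  sl2_hom (tau K n) (tens_act (tau K l) (tau K 4)) (Imap K l m n).
Proof.
move=> X _ v.
suff /lfunP/(_ v) : (Imap K l m n \o tau K n X =
    tens_act (tau K l) (tau K 4) X \o Imap K l m n)%VF by rewrite !comp_lfunE.
apply: hpoly_lfunP => k kn; rewrite !comp_lfunE; apply: tcoef_eq => j i jl i4.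
rewrite tcoef_tens_act tau_hmon // !linearD !linearZ /= !tcoef_Imap.
rewrite /GRing.scale /= -!mulrA !(mulrA (_%:~R) (_%:~R) (_^-1)) -!mulrDl.
(* Over the common denominator, the E and F parts are the integer recursions. *)
rewrite -!intrM -!intrD -Imap_num_recE // -Imap_num_recF //.
rewrite (mulNr k%:Z) intrN mulNr mulrN.
congr (_ * (_%:~R / _) - _ + _).
(* Only the H part is left: j + i = k + 2 - m gives l - 2j + 4 - 2i = n - 2k. *)
rewrite /Imap_num; case: ifP => [/and3P[_ _ /eqP e]|_]; last by rewrite !mulr0.
by congr (_ * _); lia.
Qed.

(** The image of v_0 has weight n, while v_j (x) w_i has weight l + 4 - 2(j + i). *)
Lemma hom_recH (f : 'Hom(hpoly K n, tens (hpoly K l) (hpoly K 4))) (j i : int) :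
  sl2_hom (tau K n) (tens_act (tau K l) (tau K 4)) f ->
  j + i != 2 - m -> tcoef K l 4 j i (f (hmon K n 0)) = 0.
Proof.
move=> hf ji.
pose X : 'M[K]_2 := delta_mx 0 0 - delta_mx 1 1.
have X0 : X \in @sl2 K.
  by rewrite inE /mxtrace !big_ord_recl big_ord0 !mxE /= addr0 subr0 sub0r subrr.
have := congr1 (tcoef K l 4 j i) (hf X X0 (hmon K n 0)).
rewrite tcoef_tens_act tau_hmon // !mxE /= !(subr0, mul0r, scale0r, addr0, mul1r).
rewrite linearZ linearZ /= /GRing.scale /= => /eqP.
rewrite -subr_eq0 -mulrBl -intrB mulf_eq0 intr_eq0 => /orP[|/eqP //].
lia.
Qed.

(** Since E v_0 = 0, E kills the image of v_0; this is the resulting coordinate at v_j (x) w_i, up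
    to sign. *)
Lemma hom_recE (f : 'Hom(hpoly K n, tens (hpoly K l) (hpoly K 4))) (j i : int) :
  sl2_hom (tau K n) (tens_act (tau K l) (tau K 4)) f ->
  (j + 1)%:~R * tcoef K l 4 (j + 1) i (f (hmon K n 0)) +
  (i + 1)%:~R * tcoef K l 4 j (i + 1) (f (hmon K n 0)) = 0.
Proof.
move=> hf.
pose X : 'M[K]_2 := delta_mx 0 1.
have X0 : X \in @sl2 K by rewrite inE /mxtrace !big_ord_recl big_ord0 !mxE /= !addr0.
have := congr1 (tcoef K l 4 j i) (hf X X0 (hmon K n 0)).
rewrite tcoef_tens_act tau_hmon // !mxE /=.
rewrite !(mulr0, oppr0, mul0r, scale0r, addr0, add0r, mul1r, linear0).
by move=> /esym/eqP; rewrite oppr_eq0 => /eqP.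
Qed.

(** Induction on k by F v_k = (k - n) v_{k+1}, where k - n is nonzero in [K] for k < n. *)
Lemma hom_eq0 (f : 'Hom(hpoly K n, tens (hpoly K l) (hpoly K 4))) :
  sl2_hom (tau K n) (tens_act (tau K l) (tau K 4)) f ->
  f (hmon K n 0) = 0 -> f = 0.
Proof.
move=> hf f0; apply: hpoly_lfunP => k; rewrite zero_lfunE.
elim: k => // k IH kn.
pose X : 'M[K]_2 := delta_mx 1 0.
have X0 : X \in @sl2 K by rewrite inE /mxtrace !big_ord_recl big_ord0 !mxE /= !addr0.
have := hf X X0 (hmon K n k).
rewrite IH ?(ltnW kn) // linear0 tau_hmon ?(ltnW kn) // !mxE /=.
rewrite !(mul0r, scale0r, add0r, mul1r) linearZ /= => /eqP.
rewrite scaler_eq0 intr_eq0 -PoszD addn1 => /orP[|/eqP //].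
lia.
Qed.

(** On the line j + i = 2 - m, [hom_recE] expresses the coordinate at (j, i + 1) by that at (j + 1,
    i), so all follow from the one at i = 0. *)
Lemma hom_coef0_eq0 (f : 'Hom(hpoly K n, tens (hpoly K l) (hpoly K 4))) :
  sl2_hom (tau K n) (tens_act (tau K l) (tau K 4)) f ->
  tcoef K l 4 (2 - m) 0 (f (hmon K n 0)) = 0 -> f = 0.
Proof.
move=> hf f0; apply: hom_eq0 => //; apply: tcoef_eq => j i _ _; rewrite linear0.
have [ji|/hom_recH -> //] := eqVneq (j%:Z + i%:Z) (2 - m).
elim: i j%:Z ji => [|i IH] {}j ji.
  by rewrite (_ : j = 2 - m) //; lia.
have := hom_recE _ j i hf; rewrite IH; last by lia.
rewrite mulr0 add0r -PoszD addn1 => /eqP.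
by rewrite mulf_eq0 intr_eq0 => /orP[|/eqP].
Qed.

End Hom.

(** * The generator and its uniqueness up to a scalar *)

Lemma Imap_generator_unique (K : numFieldType) (l n : nat) (m : int)
    (hm : - 2 <= m <= 2) (hn : n%:Z = l%:Z + 2 * m)
    (hocc : sl2_occurs (tau K n) (tens_act (tau K l) (tau K 4))) :
  let rho := tau K n in
  let sigma := tens_act (tau K l) (tau K 4) in
  let I := Imap K l m n in
  [/\ I != 0,
      sl2_hom_generator rho sigma I
    & forall J : 'Hom(hpoly K n, tens (hpoly K l) (hpoly K 4)),
        sl2_hom_generator rho sigma J ->
        exists2 c : K, c != 0 & J = c *: I].
Proof.
move=> rho sigma I.
have lm : 2 <= l%:Z + m.
  case: hocc => f hf finj; rewrite leNgt; apply/negP => lm.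
  have f0 : f = 0.
    (* For l + m < 2 the index 2 - m exceeds l. *)
    apply: (hom_coef0_eq0 _ _ _ _ hm hn _ hf); apply: tcoef_out; lia.
  have : hmon K n 0 = 0 by apply: finj; rewrite f0 !zero_lfunE.
  move/(congr1 (hcoef _ n 0)); rewrite hcoef_hmon linear0 /= => /eqP.
  by rewrite oner_eq0.
(* The normalisation is a(l,2m;0,0) = d(l,2m), nonzero because 2 <= l + m. *)
have I00 : tcoef _ l 4 (2 - m) 0 (I (hmon _ n 0)) = 1.
  rewrite tcoef_Imap // /Imap_num ifT; last by lia.
  by rewrite coefz_00 // divff // intr_eq0 coef_den_neq0.
have I0 : I != 0.
  apply/eqP => e; move: I00; rewrite e zero_lfunE linear0 => /esym/eqP.
  by rewrite oner_eq0.
have homI : sl2_hom rho sigma I by exact: Imap_hom.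
have genI (g : 'Hom(_, _)) : sl2_hom rho sigma g -> exists c, g = c *: I.
  (* With this [c], the homomorphism g - c I has determining coordinate 0. *)
  move=> hg; set c := tcoef _ l 4 (2 - m) 0 (g (hmon _ n 0)); exists c.
  have subE u : (g - c *: I) u = g u - c *: I u.
    by rewrite add_lfunE opp_lfunE scale_lfunE.
  apply/eqP; rewrite -subr_eq0; apply/eqP.
  apply: (hom_coef0_eq0 _ _ _ _ hm hn) => [X hX v|].
    by rewrite !subE (hg X hX v) (homI X hX v) linearB [in RHS]linearZ.
  by rewrite subE linearB linearZ /= I00 /GRing.scale /= mulr1 subrr.
split=> // J [homJ genJ]; have [c Jc] := genI J homJ; exists c => //.
(* As [J] is also a generator, I is a multiple of J, so c = 0 would give I = 0. *)
apply: contra_neq I0 => c0; have [d ->] := genJ I homI.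
by rewrite Jc c0 scale0r scaler0.
Qed.

Theorem proposition4p2 (R : realType) (l n : nat) (m : int)
    (hm : - 2 <= m <= 2) (hn : n%:Z = l%:Z + 2 * m)
    (hocc : sl2_occurs (tau R[i] n) (tens_act (tau R[i] l) (tau R[i] 4))) :
  let rho := tau R[i] n in
  let sigma := tens_act (tau R[i] l) (tau R[i] 4) in
  let I := Imap R[i] l m n in
  [/\ I != 0,
      sl2_hom_generator rho sigma I
    & forall J : 'Hom(hpoly R[i] n, tens (hpoly R[i] l) (hpoly R[i] 4)),
        sl2_hom_generator rho sigma J ->
        exists2 c : R[i], c != 0 & J = c *: I].
Proof. exact: Imap_generator_unique. Qed.
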